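(* Consider the Stratonovich SDE $$\mathrm{d}X(t)=\sum_{m=0}^M\bigl(A_mX(t)+g_m(X(t))\bigr)\circ \mathrm{d}W_m(t),\qquad X(t_0)=X_0,\quad t\in[t_0,T],$$ let $D\in\mathbb{R}^{d\times d}$ be symmetric, and put $\mathcal{I}(x)=x^\top D x$ for $x\in\mathbb{R}^d$. Assume: (i) $A_lA_k-A_kA_l=0$ for all $l,k=0,\dots,M$; (ii) each $A_m$, $m=0,\dots,M$, is skew-symmetric and commutes with $D$; (iii) $x^\top D g_m(x)=0$ for all $x\in\mathbb{R}^d$ and all $m=0,\dots,M$; (iv) $g_m\equiv 0$ for $m=1,\dots,M$. Let $Y_0=X_0,Y_1,\dots,Y_N$ be the discrete time approximations by the trapezoidal full stochastic Lawson (FSL) scheme with equidistant step size $h$, i.e. satisfying for $n=0,\dots,N-1$ $$Y_{n+1}=e^{\Delta L^n}Y_n+\sum_{m=0}^M\bigl(e^{\Delta L^n}g_m(Y_n)+g_m(Y_{n+1})\bigr)\frac{\Delta W_m^n}{2}.$$ Then for all $n=0,\dots,N$ $$\mathcal{I}(Y_n)-\mathcal{I}(Y_0)=-\frac14\Bigl(g_0(Y_n)^\top D g_0(Y_n)-g_0(Y_0)^\top D g_0(Y_0)\Bigr)h^2 .$$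
   Context: $W_0(t)=t$ and $W_1,\dots,W_M$ are independent one-dimensional Wiener processes; $\circ$ denotes Stratonovich integration. $A_0,\dots,A_M\in\mathbb{R}^{d\times d}$ are constant matrices, $g_m\in C^1(\mathbb{R}^d,\mathbb{R}^d)$, and the SDE is assumed to have a unique solution for every $X_0\in\mathbb{R}^d$. Discretization points are $t_n=t_0+nh$, $n=0,\dots,N$, $t_N=T$; increments are $\Delta W_m^n=W_m(t_{n+1})-W_m(t_n)$ for $m=0,\dots,M$ (so $\Delta W_0^n=h$), and $\Delta L^n=\sum_{m=0}^MA_m\Delta W_m^n$. ''Full'' stochastic Lawson scheme means that linear diffusion terms are included in the exponential ($A_m\neq0$ for at least one $m\ge1$); by (iv) the diffusion is here entirely linear and entirely included in the exponential. The scheme is implicit; $Y_{n+1}$ is assumed to be a solution of the displayed equation. *)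

(* Defs.v *)
From HB Require Import structures.
From mathcomp Require Import all_boot all_order all_algebra.
From mathcomp Require Import all_classical all_reals all_analysis.

Set Implicit Arguments.
Unset Strict Implicit.
Unset Printing Implicit Defensive.

Import Order.TTheory GRing.Theory Num.Theory.
Import numFieldNormedType.Exports.

Local Open Scope classical_set_scope.
Local Open Scope ring_scope.

Section linear_algebra.
Context {R : realType} {d : nat}.

Definition expmx (B : 'M[R]_d) : 'M[R]_d :=
  lim (series (fun k => (k`!%:R)^-1 *: B ^+ k) @ \oo).

Definition quad (D : 'M[R]_d) (x : 'cV[R]_d) : R := (x^T *m D *m x) 0 0.

Definition C1 (f : 'cV[R]_d -> 'cV[R]_d) : Prop :=
  (forall x, differentiable f x) /\
  (forall v, continuous (fun x => 'd f x v)).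

End linear_algebra.

(* Processes are functions R -> Omega -> _; a process on [a, b] is one whose
   values at times outside [a, b] are never looked at. *)
Section stochastic_processes.
Context {dO : measure_display} {Omega : measurableType dO} {R : realType}.
Variable P : probability Omega R.

(* Standard one-dimensional Wiener process on [0, +oo[; normal_prob takes the
   mean and the standard deviation. *)
Definition wiener_process (V : R -> Omega -> R) : Prop :=
  [/\ forall t, 0 <= t -> measurable_fun [set: Omega] (V t),
      {ae P, forall w, V 0 w = 0},
      forall (n : nat) (tau : nat -> R) (B : nat -> set R),
        0 <= tau 0%N -> (forall i, tau i <= tau i.+1) ->
        (forall i, measurable (B i)) ->
        P [set w | forall i : 'I_n, B i (V (tau i.+1) w - V (tau i) w)] =
        (\prod_(i < n) P [set w | B i (V (tau i.+1) w - V (tau i) w)%R])%E,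
      forall (s t : R) (B : set R), 0 <= s -> s < t -> measurable B ->
        P [set w | B (V t w - V s w)] = normal_prob 0 (Num.sqrt (t - s)) B
    & {ae P, forall w, {within `[0, +oo[, continuous (fun t => V t w)}}].

Definition process_sigma_algebra (V : R -> Omega -> R) : set (set Omega) :=
  <<s [set E | exists t (B : set R),
         [/\ 0 <= t, measurable B & E = V t @^-1` B]] >>.

(* Taking some of the E m equal to setT gives the product rule for every
   subfamily. *)
Definition independent_processes (M : nat) (V : 'I_M -> R -> Omega -> R) : Prop :=
  forall E : 'I_M -> set Omega,
    (forall m, process_sigma_algebra (V m) (E m)) ->
    P [set w | forall m, E m w] = (\prod_(m < M) P (E m))%E.

(* W_0(t) = t, and W_1, ..., W_M are independent Wiener processes. *)
Definition driving_processes (M : nat) (W : 'I_M.+1 -> R -> Omega -> R) : Prop :=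
  [/\ forall t w, W ord0 t w = t,
      forall m : 'I_M, wiener_process (W (lift ord0 m))
    & independent_processes (fun m : 'I_M => W (lift ord0 m))].

(* The filtration generated by W, augmented by the P-null events. *)
Definition augmented_filtration (M : nat) (W : 'I_M.+1 -> R -> Omega -> R)
    (t : R) : set (set Omega) :=
  <<s [set E | exists m s (B : set R),
         [/\ 0 <= s, s <= t, measurable B & E = W m s @^-1` B]] `|`
      [set E | measurable E /\ P E = 0%E] >>.

(* The sums of F over the consecutive intervals of the partitions of [s, u]
   converge to J in probability as the mesh tends to 0. *)
Definition cvg_partition_sums (s u : R) (F : R -> R -> Omega -> R)
    (J : Omega -> R) : Prop :=
  measurable_fun [set: Omega] J /\
  forall eps eta : R, 0 < eps -> 0 < eta -> exists2 delta : R, 0 < delta &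
    forall p : seq R, itv_partition s u p ->
      (forall i, (i < size p)%N ->
         nth u (s :: p) i.+1 - nth u (s :: p) i < delta) ->
      (P [set w | (eps <=
          `|\sum_(0 <= i < size p)
              F (nth u (s :: p) i) (nth u (s :: p) i.+1) w - J w|)%R]
         <= eta%:E)%E.

(* For Z continuous and adapted and V a continuous semimartingale. *)
Definition ito_integral (s u : R) (Z V : R -> Omega -> R) (J : Omega -> R) :=
  cvg_partition_sums s u (fun a b w => Z a w * (V b w - V a w)) J.

Definition covariation (s u : R) (Z V : R -> Omega -> R) (Q : Omega -> R) :=
  cvg_partition_sums s u
    (fun a b w => (Z b w - Z a w) * (V b w - V a w)) Q.

(* J(t) = int_[a, t] Z o dV = int_[a, t] Z dV + [Z, V]_t / 2 for t in [a, b].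
   Requiring a continuous covariation of bounded variation makes J a
   semimartingale. *)
Definition stratonovich_integral (a b : R) (Z V J : R -> Omega -> R) : Prop :=
  exists I Q : R -> Omega -> R,
  [/\ forall t, a <= t <= b -> ito_integral a t Z V (I t),
      forall t, a <= t <= b -> covariation a t Z V (Q t),
      {ae P, forall w, {within `[a, b], continuous (fun t => Q t w)} /\
                       bounded_variation a b (fun t => Q t w)}
    & forall t w, J t w = I t w + Q t w / 2].

Section sde.
Context {d M : nat}.
Variables (A : 'I_M.+1 -> 'M[R]_d) (g : 'I_M.+1 -> 'cV[R]_d -> 'cV[R]_d).
Variables (W : 'I_M.+1 -> R -> Omega -> R) (t0 T : R).

(* Solution of dX = sum_m (A_m X + g_m(X)) o dW_m on [t0, T], X(t0) = X0. *)
Definition sde_solution (X0 : 'cV[R]_d) (X : R -> Omega -> 'cV[R]_d) : Prop :=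
  [/\ forall t (i : 'I_d) (B : set R), t0 <= t <= T -> measurable B ->
        augmented_filtration W t [set w | B (X t w i 0)],
      {ae P, forall w, {within `[t0, T], continuous (fun t => X t w)}},
      {ae P, forall w, X t0 w = X0}
    & exists J : 'I_M.+1 -> 'I_d -> R -> Omega -> R,
        (forall m i, stratonovich_integral t0 T
           (fun t w => (A m *m X t w + g m (X t w)) i 0) (W m) (J m i)) /\
        (forall t i, t0 <= t <= T ->
           {ae P, forall w, X t w i 0 = X0 i 0 + \sum_(m < M.+1) J m i t w})].

Definition sde_unique_solution (X0 : 'cV[R]_d) : Prop :=
  exists2 X, sde_solution X0 X &
    forall X', sde_solution X0 X' ->
      {ae P, forall w, forall t, t0 <= t <= T -> X' t w = X t w}.

End sde.
End stochastic_processes.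

Section lawson_scheme.
Context {Omega : Type} {R : realType} {d M : nat}.
Variables (A : 'I_M.+1 -> 'M[R]_d) (g : 'I_M.+1 -> 'cV[R]_d -> 'cV[R]_d).
Variables (W : 'I_M.+1 -> R -> Omega -> R) (t0 h : R).

Definition grid (n : nat) : R := t0 + n%:R * h.

Definition dW (n : nat) (m : 'I_M.+1) (w : Omega) : R :=
  W m (grid n.+1) w - W m (grid n) w.

Definition dL (n : nat) (w : Omega) : 'M[R]_d :=
  \sum_(m < M.+1) dW n m w *: A m.

(* The scheme is implicit: y n.+1 is any solution of the n-th equation. The
   path y of the approximations is the one belonging to the outcome w. *)
Definition trapezoidal_lawson (N : nat) (X0 : 'cV[R]_d) (w : Omega)
    (y : nat -> 'cV[R]_d) : Prop :=
  y 0%N = X0 /\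
  forall n, (n < N)%N ->
    y n.+1 = expmx (dL n w) *m y n +
      \sum_(m < M.+1) (dW n m w / 2) *:
        (expmx (dL n w) *m g m (y n) + g m (y n.+1)).

End lawson_scheme.

(* Main.v *)
Require Import Defs.
From HB Require Import structures.
From mathcomp Require Import all_boot all_order all_algebra.
From mathcomp Require Import all_classical all_reals all_analysis.
From mathcomp Require Import ring lra.

Import Order.TTheory GRing.Theory Num.Theory.
Import numFieldNormedType.Exports.

Local Open Scope classical_set_scope.
Local Open Scope ring_scope.

(** The scheme preserves a perturbed quadratic form exactly. Since $W_0(t)=t$
    and only $g_0$ survives, a step from $y$ to $z$ reads
    $z - (h/2) g_0(z) = E (y + (h/2) g_0(y))$ with $E = e^{\Delta L}$: the Euler
    half step backwards from $z$ is the image under $E$ of the Euler half step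
    forwards from $y$. Because $x^T D g_0(x) = 0$, the cross terms
    vanish when the form $I(x) = x^T D x$ is expanded on either side, and the
    sign of the half step is squared away. As soon as $E$ preserves $I$, this
    yields $I(z) + (h^2/4) I(g_0(z)) = I(y) + (h^2/4) I(g_0(y))$, and the
    theorem is the telescoped form of this identity
    ([quad_trapezoidal_step]).

    The matrix $E$ preserves $I$ ([quad_expmx]) because $\Delta L$ is a linear
    combination of skew-symmetric matrices commuting with $D$, so that
    $E^T D E = e^{-\Delta L} e^{\Delta L} D = D$. The analytic content is
    $e^{-A} e^A = 1$ ([expmxN_mul]), for the exponential defined as the sum of
    its series. With $s_n(a, A)$ the $n$-th partial sum of $e^{aA}$, the product
    $s_n(-1, A) s_n(1, A)$ is a polynomial in $A$ whose coefficients of degree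
    between $1$ and $n - 1$ vanish by the binomial theorem. The coefficients
    left over are dominated by those of $s_n(1, X)^2 - s_n(2, X)$; evaluating
    at a scalar $c$ with $\|A^k\| \le c^k$ bounds the error by partial sums
    converging to $e^c e^c - e^{2c} = 0$. In this way the matrix identity is
    deduced from the functional equation of the real exponential. *)

(** * The exponential series of a matrix *)

(** Joins the completeness and the norm already present on matrices, so that
    absolutely convergent series of matrices converge. *)
HB.instance Definition _ (R : realType) (m n : nat) := Complete.on 'M[R]_(m, n).

Lemma norm_entry_le {R : realType} {m n : nat} (A : 'M[R]_(m, n)) i j :
  `|A i j| <= `|A|.
Proof.
rewrite [leRHS]/Num.norm /= mx_normrE; apply/bigmax_geP; right.
by exists (i, j).
Qed.

Lemma norm_mx_bound {R : realType} {m n : nat} (A : 'M[R]_(m, n)) (c : R) :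
  0 <= c -> (forall i j, `|A i j| <= c) -> `|A| <= c.
Proof.
move=> c0 Ac; rewrite [leLHS]/Num.norm /= mx_normrE.
by apply: bigmax_le => // -[i j] _; exact: Ac.
Qed.

Lemma norm_mulmx_le {R : realType} {m n p : nat} (A : 'M[R]_(m, n))
  (B : 'M[R]_(n, p)) : `|A *m B| <= n%:R * `|A| * `|B|.
Proof.
apply: norm_mx_bound => [|i j]; first by rewrite !mulr_ge0.
rewrite mxE (le_trans (ler_norm_sum _ _ _))//.
rewrite (le_trans (ler_sum _ (G := fun=> `|A| * `|B|) _))//.
  by move=> k _; rewrite normrM ler_pM ?norm_entry_le.
by rewrite sumr_const card_ord -mulrA mulr_natl.
Qed.

(** The norm is the largest modulus of an entry, which is not
    submultiplicative; the factor [d] repairs this. At [k = 0] the bound is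
    [1] even for [d = 0]. *)
Lemma norm_mxX_le {R : realType} {d : nat} (A : 'M[R]_d) k :
  `|A ^+ k| <= (d%:R * `|A|) ^+ k.
Proof.
elim: k => [|k IH].
  apply: norm_mx_bound => // i j.
  by rewrite mxE; case: (i == j); rewrite ?normr1 ?normr0.
by rewrite !exprS (le_trans (norm_mulmx_le _ _))// ler_wpM2l// mulr_ge0.
Qed.

Lemma cvg_expmx {R : realType} {d : nat} (A : 'M[R]_d) :
  series (fun k => (k`!%:R)^-1 *: A ^+ k) @ \oo --> expmx A.
Proof.
apply: normed_cvg.
apply: series_le_cvg (is_cvg_series_exp_coeff (d%:R * `|A|)) => k //=.
  by rewrite exp_coeff_ge0// mulr_ge0.
rewrite normrZ ger0_norm ?invr_ge0// mulrC ler_wpM2r ?invr_ge0//.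
exact: norm_mxX_le.
Qed.

Lemma cvg_expmx_entry {R : realType} {d : nat} (A : 'M[R]_d) i j :
  (series (fun k => (k`!%:R)^-1 *: A ^+ k) n i j) @[n --> \oo]
    --> expmx A i j.
Proof.
exact: (cvg_comp _ _ (cvg_expmx A) (@coord_continuous _ _ _ i j _)).
Qed.

(** * Transposition and commutation *)

Lemma trmxX {R : comPzRingType} {d : nat} (A : 'M[R]_d) k :
  (A ^+ k)^T = A^T ^+ k.
Proof.
elim: k => [|k IH]; first exact: trmx1.
by rewrite exprS exprSr -IH; exact: trmx_mul.
Qed.

Lemma trmx_expmx {R : realType} {d : nat} (A : 'M[R]_d) :
  (expmx A)^T = expmx A^T.
Proof.
apply/matrixP => i j; rewrite mxE.
apply: (cvg_unique (@Rhausdorff R) (cvg_expmx_entry A j i)).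
apply: cvg_trans (cvg_expmx_entry A^T i j).
apply: near_eq_cvg; apply: nearW => n.
rewrite /series /= !summxE; apply: eq_bigr => k _.
by rewrite -trmxX !mxE.
Qed.

Lemma cvg_mulmx_entry {R : realType} {m n p : nat} (u : nat -> 'M[R]_(m, n))
    (v : nat -> 'M[R]_(n, p)) (A : 'M[R]_(m, n)) (B : 'M[R]_(n, p)) :
  (forall i j, u N i j @[N --> \oo] --> A i j) ->
  (forall i j, v N i j @[N --> \oo] --> B i j) ->
  forall i j, (u N *m v N) i j @[N --> \oo] --> (A *m B) i j.
Proof.
move=> uA vB i j; rewrite mxE.
under eq_cvg do rewrite mxE.
by apply: cvg_big => [|k _]; [exact: add_continuous|exact: cvgM].
Qed.

Lemma expmx_comm {R : realType} {d : nat} (A D : 'M[R]_d) :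
  A *m D = D *m A -> expmx A *m D = D *m expmx A.
Proof.
move=> AD; apply/matrixP => i j.
pose s n := series (fun k => (k`!%:R)^-1 *: A ^+ k) n.
have sD n : s n *m D = D *m s n.
  rewrite mulmx_suml mulmx_sumr; apply: eq_bigr => k _.
  rewrite -scalemxAl -scalemxAr; congr (_ *: _).
  exact: (esym (commrX k (esym AD : GRing.comm D A))).
have sDl : (s n *m D) i j @[n --> \oo] --> (expmx A *m D) i j.
  by apply: cvg_mulmx_entry => k l; [exact: cvg_expmx_entry|exact: cvg_cst].
have sDr : (s n *m D) i j @[n --> \oo] --> (D *m expmx A) i j.
  under eq_cvg do rewrite sD.
  by apply: cvg_mulmx_entry => k l; [exact: cvg_cst|exact: cvg_expmx_entry].
exact: cvg_unique sDl sDr.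
Qed.

(** * The inverse of the exponential *)

(** The partial sums of the series of $e^{aX}$, as polynomials in $X$: products
    of partial sums are compared through their coefficients, whether they are
    then evaluated at a matrix or at a real number. *)
Definition exp_poly {R : realType} (a : R) n : {poly R} :=
  \poly_(i < n) (a ^+ i / i`!%:R).

Lemma horner_mx_poly {R : comNzRingType} {d : nat} (A : 'M[R]_d.+1) n
    (f : nat -> R) :
  horner_mx A (\poly_(i < n) f i) = \sum_(i < n) f i *: A ^+ i.
Proof.
rewrite poly_def raddf_sum; apply: eq_bigr => i _ /=.
by rewrite horner_mxZ rmorphXn /= horner_mx_X.
Qed.

Lemma horner_mx_exp_poly {R : realType} {d : nat} (A : 'M[R]_d.+1) a n :
  horner_mx A (exp_poly a n) = series (fun k => (k`!%:R)^-1 *: (a *: A) ^+ k) n.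
Proof.
rewrite horner_mx_poly /series /= big_mkord; apply: eq_bigr => i _.
by rewrite exprZn scalerA mulrC.
Qed.

Lemma horner_exp_poly {R : realType} (a c : R) n :
  (exp_poly a n).[c] = series (exp_coeff (a * c)) n.
Proof.
rewrite horner_poly /series /= big_mkord; apply: eq_bigr => i _.
by rewrite /exp_coeff /= exprMn mulrAC.
Qed.

(** Below the truncation order, the product has the coefficients of
    $e^{(a+b)X}$; this is the binomial theorem. *)
Lemma coef_exp_polyM {R : realType} (a b : R) n k : (k < n)%N ->
  (exp_poly a n * exp_poly b n)`_k = (a + b) ^+ k / k`!%:R.
Proof.
move=> kn; rewrite coefM addrC exprDn mulr_suml; apply: eq_bigr => -[i /=] ik _.
rewrite !coef_poly (leq_ltn_trans _ kn) ?(leq_ltn_trans (leq_subr _ _) kn)//.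
rewrite -(bin_fact (n := k) (m := i))// !natrM -mulr_natr.
have fact_neq0 j : j`!%:R != 0 :> R by rewrite pnatr_eq0 -lt0n fact_gt0.
have bin_neq0 : 'C(k, i)%:R != 0 :> R by rewrite pnatr_eq0 -lt0n bin_gt0.
by field; rewrite !fact_neq0 bin_neq0.
Qed.

(** A polynomial with dominating nonnegative coefficients, evaluated at the
    scalar that dominates the powers of [A], bounds the value at [A]. *)
Lemma norm_horner_mx_le {R : realType} {d : nat} (A : 'M[R]_d.+1)
    (q r : {poly R}) :
  (forall k, `|q`_k| <= r`_k) -> `|horner_mx A q| <= r.[d.+1%:R * `|A|].
Proof.
move=> qr; set N := maxn (size q) (size r).
rewrite -[q](take_poly_id (leq_maxl _ (size r))) horner_mx_poly.
rewrite (horner_coef_wide _ (leq_maxr (size q) _)).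
rewrite (le_trans (ler_norm_sum _ _ _))// ler_sum// => i _.
by rewrite normrZ ler_pM ?norm_mxX_le.
Qed.

(** In degree at most [n] both sides vanish. In higher degree the truncated
    [exp_poly 2] contributes nothing, and the signs in [exp_poly (-1)] can only
    produce cancellation. The order is [n.+1] because at order [0] the constant
    term [1] is not matched. *)
Lemma norm_exp_poly_coef_le {R : realType} n k :
  `|(exp_poly (-1) n.+1 * exp_poly 1 n.+1 - 1 : {poly R})`_k| <=
    (exp_poly 1 n.+1 * exp_poly 1 n.+1 - exp_poly 2 n.+1 : {poly R})`_k.
Proof.
rewrite !coefB coefC [(exp_poly 2 _)`_k]coef_poly.
have [kn|nk] := ltnP k n.+1.
  rewrite !coef_exp_polyM// addNr subrr expr0n.
  by case: k {kn} => [|k]; rewrite /= ?fact0 ?divr1 ?mul0r ?subrr ?normr0.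
rewrite (gtn_eqF (leq_trans _ nk))// !subr0 !coefM.
rewrite (le_trans (ler_norm_sum _ _ _))// ler_sum// => i _.
have norm_coef (a : R) j : `|a| = 1 ->
    `|(exp_poly a n.+1)`_j| = (exp_poly 1 n.+1)`_j.
  move=> a1; rewrite !coef_poly; case: ifP => _; last exact: normr0.
  by rewrite normrM normrX a1 ger0_norm ?invr_ge0.
by rewrite normrM !norm_coef ?normrN ?normr1.
Qed.

Lemma expmxN_mul {R : realType} {d : nat} (A : 'M[R]_d) :
  expmx (- A) *m expmx A = 1%:M.
Proof.
(* Evaluation of polynomials needs the nontrivial ring of matrices of positive
   size; in size 0 all matrices are equal. *)
case: d A => [|d] A; first by apply/matrixP => -[].
pose s a n := series (fun k => (k`!%:R)^-1 *: (a *: A) ^+ k) n.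
set c := d.+1%:R * `|A|.
pose e n := series (exp_coeff c) n * series (exp_coeff c) n -
  series (exp_coeff (c + c)) n.
have se n : `|s (-1) n.+1 *m s 1 n.+1 - 1%:M| <= e n.+1.
  rewrite /s -!horner_mx_exp_poly.
  have -> : horner_mx A (exp_poly (-1) n.+1) *m horner_mx A (exp_poly 1 n.+1)
      - 1%:M = horner_mx A (exp_poly (-1) n.+1 * exp_poly 1 n.+1 - 1).
    by rewrite -polyC1 rmorphB rmorphM /= horner_mx_C.
  have := norm_horner_mx_le A _ _ (norm_exp_poly_coef_le n).
  by rewrite hornerD hornerN hornerM -/c !horner_exp_poly mul1r mulr_natl.
have e0 : e n.+1 @[n --> \oo] --> 0.
  have cvg_exp (x : R) : series (exp_coeff x) @ \oo --> expR x.
    exact: is_cvg_series_exp_coeff.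
  have := cvgB (cvgM (cvg_exp c) (cvg_exp c)) (cvg_exp (c + c)).
  by rewrite expRD subrr (cvg_shiftS e); apply; exact: eventually_filter.
apply/matrixP => i j.
have s_1 : (s (-1) n.+1 *m s 1 n.+1) i j @[n --> \oo] -->
    (1%:M : 'M[R]_d.+1) i j.
  apply/cvgrPdist_le => /= eps eps0.
  move/cvgr0Pnorm_le : e0 => /(_ _ eps0); apply: filterS => n.
  apply: le_trans; rewrite distrC; apply: le_trans (le_trans (se n) (ler_norm _)).
  by have := norm_entry_le (s (-1) n.+1 *m s 1 n.+1 - 1%:M) i j; rewrite !mxE.
have s_exp : (s (-1) n.+1 *m s 1 n.+1) i j @[n --> \oo] -->
    (expmx (- A) *m expmx A) i j.
  rewrite (cvg_shiftS (fun n => (s (-1) n *m s 1 n) i j)).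
  have cvg_s a B k l : a *: A = B -> s a n k l @[n --> \oo] --> expmx B k l.
    by move=> <-; exact: cvg_expmx_entry.
  by apply: cvg_mulmx_entry => k l; apply: cvg_s; rewrite ?scaleN1r ?scale1r.
exact: cvg_unique s_exp s_1.
Qed.

(** * Quadratic forms along the scheme *)

Lemma quad_expmx {R : realType} {d : nat} (A D : 'M[R]_d) (x : 'cV[R]_d) :
  A^T = - A -> A *m D = D *m A -> quad D (expmx A *m x) = quad D x.
Proof.
move=> skewA AD; rewrite /quad trmx_mul trmx_expmx skewA !mulmxA.
congr (fun_of_matrix (_ *m x) _ _).
by rewrite -!mulmxA -expmx_comm// (mulmxA (expmx (- A))) expmxN_mul mul1mx.
Qed.

Lemma quadD_orth {R : realType} {d : nat} (D : 'M[R]_d) (x v : 'cV[R]_d)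
    (a : R) :
  D^T = D -> x^T *m D *m v = 0 ->
  quad D (x + a *: v) = quad D x + a ^+ 2 * quad D v.
Proof.
move=> symD xDv.
have vDx : v^T *m D *m x = 0.
  by apply: trmx_inj; rewrite trmx0 !trmx_mul trmxK symD mulmxA.
have -> : quad D (x + a *: v) = ((x^T + a *: v^T) *m D *m (x + a *: v)) 0 0.
  by rewrite /quad [(x + _)^T]linearD /= [(a *: v)^T]linearZ.
rewrite /quad !(mulmxDl, mulmxDr).
rewrite -!scalemxAl -!scalemxAr xDv vDx !scaler0 addr0 add0r scalerA.
by rewrite !mxE.
Qed.

(** The conserved quantity of the trapezoidal step: the half steps
    $z - (h/2) f(z)$ and $y + (h/2) f(y)$ correspond under the isometry [E],
    and each moves orthogonally to its base point. *)
Lemma quad_trapezoidal_step {R : realType} {d : nat} (D E : 'M[R]_d)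
    (f : 'cV[R]_d -> 'cV[R]_d) (h : R) (y z : 'cV[R]_d) :
  D^T = D -> (forall x, quad D (E *m x) = quad D x) ->
  (forall x, x^T *m D *m f x = 0) ->
  z = E *m y + (h / 2) *: (E *m f y + f z) ->
  quad D z + (h / 2) ^+ 2 * quad D (f z) =
    quad D y + (h / 2) ^+ 2 * quad D (f y).
Proof.
move=> symD isoE fD zE.
have half_steps : z + (- (h / 2)) *: f z = E *m (y + (h / 2) *: f y).
  by rewrite scaleNr {1}zE scalerDr addrA addrK mulmxDr scalemxAr.
by rewrite -[in LHS]sqrrN -!quadD_orth// half_steps isoE.
Qed.

Theorem theorem3 (R : realType) (dO : measure_display)
    (Omega : measurableType dO) (P : probability Omega R)
    (d M : nat) (W : 'I_M.+1 -> R -> Omega -> R)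
    (A : 'I_M.+1 -> 'M[R]_d) (g : 'I_M.+1 -> 'cV[R]_d -> 'cV[R]_d)
    (t0 T h : R) (N : nat) (D : 'M[R]_d) (X0 : 'cV[R]_d)
    (Y : nat -> Omega -> 'cV[R]_d)
    (hd : (0 < d)%N)
    (ht0 : 0 <= t0) (htT : t0 < T) (hN : grid t0 h N = T)
    (hW : driving_processes P W)
    (hgC1 : forall m, C1 (g m))
    (hsde : forall x0, sde_unique_solution P A g W t0 T x0)
    (hfull : exists m : 'I_M, A (lift ord0 m) != 0)
    (hD : D^T = D)
    (hcomm : forall l k, A l *m A k - A k *m A l = 0)
    (hskew : forall m, (A m)^T = - A m)
    (hAD : forall m, A m *m D = D *m A m)
    (hgD : forall m x, x^T *m D *m g m x = 0)
    (hg0 : forall (m : 'I_M) x, g (lift ord0 m) x = 0) :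
  forall w : Omega,
    trapezoidal_lawson A g W t0 h N X0 w (fun n => Y n w) ->
    forall n : nat, (n <= N)%N ->
      quad D (Y n w) - quad D (Y 0%N w) =
      - (1 / 4) * (quad D (g ord0 (Y n w)) - quad D (g ord0 (Y 0%N w)))
        * h ^+ 2.
Proof.
move=> w [_ scheme] n nN.
suff inv : quad D (Y n w) + (h / 2) ^+ 2 * quad D (g ord0 (Y n w)) =
    quad D (Y 0%N w) + (h / 2) ^+ 2 * quad D (g ord0 (Y 0%N w)) by lra.
elim: n nN => [//|n IH] nN; rewrite -(IH (ltnW nN)).
have dW0 : dW W t0 h n ord0 w = h.
  by case: hW => W0 _ _; rewrite /dW !W0 /grid -natr1; lra.
apply: (quad_trapezoidal_step D (expmx (dL A W t0 h n w))) => //.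
- move=> x; apply: quad_expmx; rewrite /dL.
  + rewrite raddf_sum -sumrN; apply: eq_bigr => m _.
    by rewrite /= linearZ /= hskew scalerN.
  + rewrite mulmx_suml mulmx_sumr; apply: eq_bigr => m _.
    by rewrite -scalemxAl -scalemxAr hAD.
rewrite {1}(scheme n nN) big_ord_recl dW0 big1 ?addr0// => m _.
  by rewrite !hg0 mulmx0 addr0 scaler0.
Qed.
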